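(* Let $V$ be an irreducible $G$-module and let $E$ be a $G$-invariant $V$-embedded vector bundle on $X$, where $X$ has irreducible components $X_1,\ldots,X_k$ and $E$ has rank $N_i$ on $X_i$ for $i=1,\ldots,k$, with $N_1\ge\ldots\ge N_k$. Assume that $\alpha\in\mathbb{N}_0^k$ is such that $\alpha_i\ge N_1$ for each $i=1,\ldots,k$ and that $$\alpha_1N_1+\ldots+\alpha_kN_k>\dim V+(N_1-1)(N_1+\ldots+N_k).$$ Then $E$ is $\alpha$-filling.
   Context: All varieties are over $\mathbb{C}$. $G$ is a group, $V$ is a finite-dimensional $G$-module, and $X$ is a (quasi-)affine cone which lies in some $G$-module and is closed under the $G$-action. A $V$-embedded vector bundle $E$ on $X$ is an algebraic vector bundle $\pi\colon E\to X$ (Zariski-locally trivial) all of whose fibers $E_x=\pi^{-1}(\{x\})$, $x\in X$, are linear subspaces of $V$. Its fiber dimension is constant on each irreducible component $X_i$ and is called the rank $N_i$ of $E$ on $X_i$. $E$ is $G$-invariant (equivalently, $G$-equivariant) if $E_{gx}=gE_x$ for all $g\in G$, $x\in X$. A $G$-module is irreducible if it is nonzero and has no proper nonzero $G$-submodule. For $\alpha\in\mathbb{N}_0^k$ write $|\alpha|=\alpha_1+\ldots+\alpha_k$. A sequence $x=(x_1,\ldots,x_r)$ of points of $X$ is of (component) type $\alpha$ if exactly $\alpha_i$ of the $x_j$ lie in $X_i$ for each $i$ and no $x_j$ lies in the intersection of two components (so $r=|\alpha|$). It is a general sequence of type $\alpha$ if, in addition, each $x_j$ is a general point of one of the components. $E$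 is $\alpha$-filling if for a general sequence $x_1,\ldots,x_r$ of type $\alpha$ one has $\langle E_{x_1},\ldots,E_{x_r}\rangle=V$.
   Formalization: Added assumption: if some g in G maps component X_i onto X_j, then α_i = α_j (automatic when every component is G-stable). Without it the claim fails: GL_2 wr Z/2 on C^2⊕C^2, X the union of the two summands minus 0, E_x = Cx, α = (10,1). *)

(* Defs.v *)
From HB Require Import structures.
From mathcomp Require Import all_boot all_order all_algebra.
From mathcomp Require Import complex.
From mathcomp Require Import boolp classical_sets functions reals.
(* [mpoly] is not imported because its notations clash with those of
   [classical_sets]. *)
From mathcomp Require mpoly.

Set Implicit Arguments.
Unset Strict Implicit.
Unset Printing Implicit Defensive.

Import Order.TTheory GRing.Theory Num.Theory.
Local Open Scope classical_set_scope.
Local Open Scope ring_scope.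

Section Zariski.
Variable K : fieldType.
Implicit Types V U : vectType K.

(* Polynomials on V are polynomials in the coordinates of a fixed basis; the
   Zariski topology and the regular functions do not depend on that basis. *)
Definition coords V (v : V) : 'I_(\dim {:V}) -> K :=
  fun i => coord (vbasis {:V}) i v.

Definition peval V (p : mpoly.mpoly (\dim {:V}) K) (v : V) : K :=
  mpoly.meval (coords v) p.

Definition zariski_closed V (A : set V) : Prop :=
  exists S : set (mpoly.mpoly (\dim {:V}) K),
    A = [set v | forall p, S p -> peval p v = 0].

Definition zariski_open V (A : set V) : Prop := zariski_closed (~` A).

Definition irreducible_set V (Z : set V) : Prop :=
  Z !=set0 /\
  forall A B : set V, zariski_closed A -> zariski_closed B ->
    Z `<=` A `|` B -> Z `<=` A \/ Z `<=` B.

Definition irreducible_component V (X Z : set V) : Prop :=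
  [/\ Z `<=` X, irreducible_set Z &
      forall Z' : set V, Z' `<=` X -> irreducible_set Z' -> Z `<=` Z' -> Z' = Z].

(* A locally closed set stable under nonzero scalars: the affine cones and
   their punctured or otherwise open conical parts. *)
Definition quasi_affine_cone V (X : set V) : Prop :=
  (exists A B : set V,
     [/\ zariski_closed A, zariski_open B & X = A `&` B]) /\
  (forall (c : K) (x : V), c != 0 -> X x -> X (c *: x)).

Definition regular_function V (Y : set V) (f : V -> K) : Prop :=
  forall y, Y y -> exists O (p q : mpoly.mpoly (\dim {:V}) K),
    [/\ zariski_open O, O y &
        forall z, Y z -> O z -> peval q z != 0 /\ f z = peval p z / peval q z].

Definition regular_map V U (Y : set V) (f : V -> U) : Prop :=
  forall i, regular_function Y (fun v => coords (f v) i).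

Definition mutually_inverse_morphisms V U (Y : set V) (Y' : set U)
    (f : V -> U) (h : U -> V) : Prop :=
  [/\ regular_map Y f, regular_map Y' h,
      f @` Y `<=` Y' /\ h @` Y' `<=` Y,
      forall y, Y y -> h (f y) = y &
      forall y, Y' y -> f (h y) = y].

(* "P holds for a general point of Y"; Y may be reducible, so the open set is
   required to be dense in Y and not merely nonempty. *)
Definition for_general V (Y : set V) (P : V -> Prop) : Prop :=
  exists O : set V,
    [/\ zariski_open O,
        forall O' : set V, zariski_open O' ->
          Y `&` O' !=set0 -> Y `&` O' `&` O !=set0 &
        forall y, Y y -> O y -> P y].

End Zariski.

Section Bundles.
Variables (K : fieldType) (W V : vectType K).

Definition total_space (X : set W) (E : W -> {vspace V}) : set (W * V)%type :=
  [set p | X p.1 /\ p.2 \in E p.1].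

(* The bundle is given by its fibers E x for x in X (E is irrelevant outside X);
   its total space carries the variety structure induced from W * V. *)
Definition embedded_vector_bundle (X : set W) (E : W -> {vspace V}) : Prop :=
  forall x, X x -> exists (U : set W) (m : nat)
    (phi : W * 'rV[K]_m -> W * V) (psi : W * V -> W * 'rV[K]_m),
    [/\ zariski_open U, U x,
        mutually_inverse_morphisms
          [set p : (W * 'rV[K]_m)%type | (X `&` U) p.1]
          (total_space (X `&` U) E) phi psi,
        forall y c, (X `&` U) y -> (phi (y, c)).1 = y &
        forall y, (X `&` U) y ->
          forall a (c d : 'rV[K]_m),
            (phi (y, a *: c + d)).2 = a *: (phi (y, c)).2 + (phi (y, d)).2].

Variables (k : nat) (Xc : 'I_k -> set W) (alpha : 'I_k -> nat).

Definition sequences_of_type (X : set W) :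
    set {ffun 'I_(\sum_i alpha i) -> W} :=
  [set x | [/\ forall j, X (x j),
               forall i, #|[pred j | x j \in Xc i]| = alpha i &
               forall j i i', Xc i (x j) -> Xc i' (x j) -> i = i']].

Definition filling (X : set W) (E : W -> {vspace V}) : Prop :=
  for_general (sequences_of_type X)
    (fun x => (\sum_j E (x j))%VS = fullv).

End Bundles.

Section Modules.
Variable (G : groupType) (K : fieldType).

Record gmodule (V : vectType K) := GModule {
  gact :> G -> 'End(V);
  gact1 : gact 1%g = \1%VF;
  gactM : forall g h, gact (g * h)%g = (gact g \o gact h)%VF
}.

Definition irreducible_gmodule (V : vectType K) (rho : gmodule V) : Prop :=
  fullv != 0%VS :> {vspace V} /\
  forall U : {vspace V}, (forall g, (rho g @: U <= U)%VS) ->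
    U = 0%VS \/ U = fullv.

Definition stable_set (W : vectType K) (rho : gmodule W) (X : set W) : Prop :=
  forall g x, X x -> X (rho g x).

Definition invariant_bundle (W V : vectType K) (rhoW : gmodule W)
    (rhoV : gmodule V) (X : set W) (E : W -> {vspace V}) : Prop :=
  forall g x, X x -> E (rhoW g x) = (rhoV g @: E x)%VS.

(* G is an abstract group and may permute the irreducible components of X. A
   type alpha has to be compatible with that permutation. The condition holds
   for every alpha when each component is G-stable, e.g. when G is a connected
   algebraic group acting algebraically.
   It cannot be dropped: let the wreath product of GL_2 by Z/2 act on
   V = V1 (+) V2, Vi = C^2, let X be the union of V1 and V2 without the origin,
   E_x = C x, N = (1, 1). The type (10, 1) satisfies the numerical assumption
   11 > 4, but sequences of this type only span 3-dimensional spaces. *)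
Definition orbit_constant (W : vectType K) (rho : gmodule W) (k : nat)
    (Xc : 'I_k -> set W) (alpha : 'I_k -> nat) : Prop :=
  forall g i j, rho g @` Xc i = Xc j -> alpha i = alpha j.

End Modules.

(* Main.v *)
(* For a type gamma that is constant on the orbits of G on the components, the
   vectors v contained in <E_x1, ..., E_xr> for a general sequence of type gamma
   form a G-submodule of V. Hence if some nonzero v has this property, then a
   general sequence of type gamma spans V.
   Let gamma_t = alpha - (N_1 - 1 - t)(1, ..., 1) for 0 <= t <= N_1 - 1, and let
   c_t be the dimension of the intersection of E_y, for general y in a component
   X_i, with the span W_t of a general sequence of type gamma_t. The numerical
   assumption says that the expected dimension of W_0 exceeds dim V, so c_0 > 0
   for some i. If c_t = c_(t+1), then the intersection is not changed when
   single points of the sequence are replaced by other general points; so it is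
   contained in the span of any general sequence of type gamma_t, and that span
   is V. Otherwise c_t grows with t, so that in the end c_(N_1-1) >= N_1 >= N_i,
   which means that E_y is contained in the span of a general sequence of type
   alpha; again that span is V.
   All sequences considered are subfamilies, indexed by subsets A, of one family
   of points x_(i,a) in X_i for which every span has its maximal dimension. *)
Require Import Defs.
From HB Require Import structures.
From mathcomp Require Import all_boot all_order all_algebra.
From mathcomp Require Import complex.
From mathcomp Require Import boolp classical_sets functions reals.
From mathcomp Require mpoly.
Import (canonicals) mpoly.

Set Implicit Arguments.
Unset Strict Implicit.
Unset Printing Implicit Defensive.

Import Order.TTheory GRing.Theory Num.Theory.
Local Open Scope classical_set_scope.
Local Open Scope ring_scope.

(** * Polynomial functions and maps, and the Zariski topology they respect *)

Section PolynomialMaps.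
Variable K : fieldType.
Implicit Types T U V : vectType K.

Definition polyfun T (f : T -> K) : Prop :=
  exists p : mpoly.mpoly (\dim {:T}) K, f =1 peval p.

Definition polymap T U (f : T -> U) : Prop :=
  forall i, polyfun (fun v => coords (f v) i).

Lemma polyfun_ext T (f g : T -> K) : f =1 g -> polyfun f -> polyfun g.
Proof. by move=> fg [p fp]; exists p => v; rewrite -fg. Qed.

Lemma polyfun_peval T p : polyfun (@peval K T p).
Proof. by exists p. Qed.

Lemma polyfun_cst T c : polyfun (fun _ : T => c).
Proof. by exists (mpoly.mpolyC _ c) => v; rewrite /peval mpoly.mevalC. Qed.

Lemma polyfun_coords T i : polyfun (fun v : T => coords v i).
Proof.
by exists (mpoly.mpolyX K (mpoly.mnm1 i)) => v; rewrite /peval mpoly.mevalXU.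
Qed.

Lemma polyfunD T (f g : T -> K) :
  polyfun f -> polyfun g -> polyfun (fun v => f v + g v).
Proof.
move=> [p fp] [q gq]; exists (p + q) => v.
by rewrite /peval mpoly.mevalD fp gq.
Qed.

Lemma polyfunM T (f g : T -> K) :
  polyfun f -> polyfun g -> polyfun (fun v => f v * g v).
Proof.
move=> [p fp] [q gq]; exists (p * q) => v.
by rewrite /peval mpoly.mevalM fp gq.
Qed.

Lemma polyfun_sum T I (r : seq I) (P : pred I) (f : I -> T -> K) :
  (forall i, P i -> polyfun (f i)) ->
  polyfun (fun v => \sum_(i <- r | P i) f i v).
Proof.
move=> fP; elim: r => [|i r IH].
  by apply: polyfun_ext (polyfun_cst T 0) => v; rewrite big_nil.
case: (boolP (P i)) => Pi.
  apply: polyfun_ext (polyfunD (fP i Pi) IH) => v.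
  by rewrite big_cons Pi.
by apply: polyfun_ext IH => v; rewrite big_cons (negPf Pi).
Qed.

Lemma polyfun_prod T I (r : seq I) (P : pred I) (f : I -> T -> K) :
  (forall i, P i -> polyfun (f i)) ->
  polyfun (fun v => \prod_(i <- r | P i) f i v).
Proof.
move=> fP; elim: r => [|i r IH].
  by apply: polyfun_ext (polyfun_cst T 1) => v; rewrite big_nil.
case: (boolP (P i)) => Pi.
  apply: polyfun_ext (polyfunM (fP i Pi) IH) => v.
  by rewrite big_cons Pi.
by apply: polyfun_ext IH => v; rewrite big_cons (negPf Pi).
Qed.

(** After expanding [g] into monomials, the composite is a sum of products of coordinates of [f]. *)
Lemma polyfun_comp T U (f : T -> U) (g : U -> K) :
  polymap f -> polyfun g -> polyfun (g \o f).
Proof.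
move=> fP [p gp].
suff : polyfun (fun v => \sum_(m <- mpoly.msupp p)
    mpoly.mcoeff m p * \prod_i \prod_(l < mpoly.fun_of_multinom m i)
      coords (f v) i).
  apply: polyfun_ext => v; rewrite /= gp /peval mpoly.mevalE.
  apply: eq_bigr => m _; congr (_ * _); apply: eq_bigr => i _.
  by rewrite prodr_const card_ord.
apply: polyfun_sum => m _; apply: polyfunM; first exact: polyfun_cst.
by apply: polyfun_prod => i _; apply: polyfun_prod => l _; apply: fP.
Qed.

Lemma coords_sum T (v : T) : v = \sum_i coords v i *: (vbasis {:T})`_i.
Proof. exact: coord_vbasis (memvf v). Qed.

Lemma polymap_linear T U (f : T -> U) : linear f -> polymap f.
Proof.
move=> flin i.
pose Hf := GRing.isLinear.Build _ _ _ _ f flin.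
pose F : {linear T -> U} := HB.pack f Hf.
have fZ a u : f (a *: u) = a *: f u by exact: (linearZ_LR F).
suff : polyfun (fun v : T =>
    \sum_l coords v l * coords (F (vbasis {:T})`_l) i).
  apply: polyfun_ext => v; rewrite -[f v]/(F v) {2}(coords_sum v) linear_sum /=.
  rewrite /coords linear_sum; apply: eq_bigr => l _.
  by rewrite fZ linearZ.
apply: polyfun_sum => l _; apply: polyfunM; first exact: polyfun_coords.
exact: polyfun_cst.
Qed.

Lemma polymapD T U (f g : T -> U) :
  polymap f -> polymap g -> polymap (fun v => f v + g v).
Proof.
move=> fP gP i; apply: polyfun_ext (polyfunD (fP i) (gP i)) => v.
by rewrite /coords linearD.
Qed.

Lemma polymap_cst T U (u : U) : polymap (fun _ : T => u).
Proof. by move=> i; apply: polyfun_cst. Qed.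

Lemma polymap_sum T U I (r : seq I) (P : pred I) (f : I -> T -> U) :
  (forall i, P i -> polymap (f i)) ->
  polymap (fun v => \sum_(i <- r | P i) f i v).
Proof.
move=> fP j; suff : polyfun (fun v => \sum_(i <- r | P i) coords (f i v) j).
  by apply: polyfun_ext => v; rewrite /coords linear_sum.
by apply: polyfun_sum => i Pi; apply: fP.
Qed.

Lemma polymapZ T U (f : T -> K) (u : U) :
  polyfun f -> polymap (fun v => f v *: u).
Proof.
move=> fP i; apply: polyfun_ext (polyfunM fP (polyfun_cst T (coords u i))) => v.
by rewrite /coords linearZ.
Qed.

Lemma polymap_comp T U V (f : T -> U) (g : U -> V) :
  polymap f -> polymap g -> polymap (g \o f).
Proof. by move=> fP gP i; apply: (polyfun_comp fP (gP i)). Qed.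

Lemma polymap_affine T U (f : T -> U) (u : U) :
  linear (fun v => f v - u) -> polymap f.
Proof.
move=> /polymap_linear flin i.
have := polymapD flin (polymap_cst T u) i.
by apply: polyfun_ext => v; rewrite subrK.
Qed.

Lemma zariski_closed_bigI T I (A : I -> set T) :
  (forall i, zariski_closed (A i)) -> zariski_closed (\bigcap_i A i).
Proof.
move=> /choice[S AS]; exists (\bigcup_i S i).
apply/seteqP; split=> v Av.
  by move=> p [i _ Sip]; have := Av i Logic.I; rewrite AS; apply.
by move=> i _; rewrite AS => p Sp; apply: Av; exists i.
Qed.

Lemma zariski_closedU T (A B : set T) :
  zariski_closed A -> zariski_closed B -> zariski_closed (A `|` B).
Proof.
move=> [S ->] [S' ->]; exists [set r | exists p q, [/\ S p, S' q & r = p * q]].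
apply/seteqP; split=> v /=.
  by case=> v0 r [p [q [Sp Sq ->]]]; rewrite /peval mpoly.mevalM;
     [rewrite -/(peval p v) v0 // mul0r | rewrite -/(peval q v) v0 // mulr0].
move=> v0; apply: contrapT => /not_orP[/existsNP[p /not_implyP[Sp /eqP pv]]].
move=> /existsNP[q /not_implyP[Sq /eqP qv]].
have /eqP := v0 (p * q) ltac:(by exists p, q).
by rewrite /peval mpoly.mevalM mulf_eq0 (negPf pv) (negPf qv).
Qed.

Lemma zariski_closed_preimage T U (f : T -> U) (A : set U) :
  polymap f -> zariski_closed A -> zariski_closed (f @^-1` A).
Proof.
move=> fP [S ->].
exists [set p | exists2 q, S q & peval q \o f =1 peval p].
apply/seteqP; split=> v /=.
  by move=> v0 p [q Sq qp]; rewrite -qp; apply: v0.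
move=> v0 q Sq; have [p qp] := polyfun_comp fP (polyfun_peval q).
by have := v0 p; rewrite -qp; apply; exists q.
Qed.

Lemma zariski_openI T (A B : set T) :
  zariski_open A -> zariski_open B -> zariski_open (A `&` B).
Proof. by rewrite /zariski_open setCI; apply: zariski_closedU. Qed.

Lemma zariski_openT T : zariski_open [set: T].
Proof.
exists setT; apply/seteqP; split=> v //= v0; have := v0 1 Logic.I.
by rewrite /peval mpoly.meval1 => /eqP; rewrite oner_eq0.
Qed.

Lemma zariski_open_preimage T U (f : T -> U) (A : set U) :
  polymap f -> zariski_open A -> zariski_open (f @^-1` A).
Proof.
move=> fP Ao; rewrite /zariski_open preimage_setC.
exact: zariski_closed_preimage.
Qed.

Lemma zariski_open_bigU T I (A : I -> set T) :
  (forall i, zariski_open (A i)) -> zariski_open (\bigcup_i A i).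
Proof.
by move=> Ao; rewrite /zariski_open setC_bigcup; apply: zariski_closed_bigI.
Qed.

Lemma zariski_open_bigI_fin T (I : finType) (A : I -> set T) :
  (forall i, zariski_open (A i)) -> zariski_open [set v | forall i, A i v].
Proof.
move=> Ao; suff H (s : seq I) : zariski_open [set v | forall i, i \in s -> A i v].
  have := H (enum I); congr zariski_open; apply/seteqP; split=> v /= Av i //.
  by apply: Av; rewrite mem_enum.
elim: s => [|i s IH].
  have := zariski_openT T; congr zariski_open; apply/seteqP; split=> v //.
have := zariski_openI (Ao i) IH; congr zariski_open; apply/seteqP; split=> v /=.
  by move=> [Av sv] l; rewrite inE => /predU1P[->//|/sv].
by move=> sv; split=> [|l ls]; apply: sv; rewrite inE ?eqxx ?ls ?orbT.
Qed.

Lemma zariski_open_neq0 T (f : T -> K) :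
  polyfun f -> zariski_open [set v | f v != 0].
Proof.
move=> [p fp]; exists [set p]; apply/seteqP; split=> v /=.
  by move=> /negP; rewrite negbK fp => /eqP v0 _ ->.
by move=> /(_ p erefl) v0; apply/negP; rewrite negbK fp v0.
Qed.

(** The union of all open sets on which [P] holds along [Y] does it. *)
Lemma zariski_open_locally T (Y : set T) (P : T -> Prop) :
  (forall y, Y y -> P y ->
     exists O, [/\ zariski_open O, O y & forall z, Y z -> O z -> P z]) ->
  exists2 O, zariski_open O & forall y, Y y -> O y <-> P y.
Proof.
move=> loc.
pose I := {O : set T | zariski_open O /\ forall z, Y z -> O z -> P z}.
exists (\bigcup_(i : I) sval i).
  by apply: zariski_open_bigU => -[O []].
move=> y Yy; split=> [[[O [Oo OP]] _ /= Oy]|Py]; first exact: OP.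
by have [O [Oo Oy OP]] := loc y Yy Py; exists (exist _ O (conj Oo OP)).
Qed.

End PolynomialMaps.

(** * Polynomial local sections of families of subspaces *)

Section PolynomialSections.
Variable K : fieldType.
Implicit Types T U V W : vectType K.

(** A consequence of local triviality that also passes to sums of fibers, whose dimension may
    jump. *)
Definition poly_sections T V (Y : set T) (F : T -> {vspace V}) : Prop :=
  forall x v, Y x -> v \in F x -> exists O (s : T -> V),
    [/\ zariski_open O, O x, polymap s, s x = v &
        forall y, Y y -> O y -> s y \in F y].

(** Each basis vector is split along [C] and [F x], and its second part is extended to a section.
    The resulting vectors form the identity matrix at [x], so near [x] their determinant is nonzero
    and they still span. With [C] a complement of [F x], this gives semicontinuity of the
    dimension. *)
Lemma poly_sections_full T V (Y : set T) (F : T -> {vspace V})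
    (C : {vspace V}) (x : T) :
  poly_sections Y F -> Y x -> (C + F x)%VS = fullv ->
  exists O, [/\ zariski_open O, O x &
                forall y, Y y -> O y -> (C + F y)%VS = fullv].
Proof.
move=> secF Yx full_x; pose n := \dim {:V}.
have /choice[cu cuP] (a : 'I_n) : exists cu : V * V,
    [/\ cu.1 \in C, cu.2 \in F x & (vbasis {:V})`_a = cu.1 + cu.2].
  have : (vbasis {:V})`_a \in (C + F x)%VS by rewrite full_x memvf.
  by case/memv_addP=> c Cc [u Fu ->]; exists (c, u).
have /choice[Os OsP] (a : 'I_n) : exists Os : set T * (T -> V),
    [/\ zariski_open Os.1, Os.1 x, polymap Os.2, Os.2 x = (cu a).2 &
        forall y, Y y -> Os.1 y -> Os.2 y \in F y].
  have [_ Fu _] := cuP a; have [O [s ?]] := secF _ _ Yx Fu.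
  by exists (O, s).
pose t y a := (cu a).1 + (Os a).2 y.
pose M y := \matrix_(a < n, l < n) coords (t y a) l.
have entryP a l : polyfun (fun y => M y a l).
  have [_ _ sP _ _] := OsP a.
  have := polymapD (polymap_cst T (cu a).1) sP l.
  by apply: polyfun_ext => y; rewrite mxE.
have detM : polyfun (fun y => \det (M y)).
  apply: polyfun_sum => p _; apply: polyfunM; first exact: polyfun_cst.
  by apply: polyfun_prod => a _; apply: entryP.
exists ([set y | forall a, (Os a).1 y] `&` [set y | \det (M y) != 0]); split.
- apply: zariski_openI; last exact: zariski_open_neq0.
  by apply: zariski_open_bigI_fin => a; have [] := OsP a.
- split=> [a|]; first by have [] := OsP a.
  rewrite /=; suff -> : M x = 1%:M by rewrite det1 oner_neq0.
  apply/matrixP => a l; rewrite !mxE /t.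
  have [_ _ _ -> _] := OsP a; have [_ _ <-] := cuP a.
  by rewrite /coords coord_free ?(basis_free (vbasisP _)) // eq_sym.
move=> y Yy [/= Oy detMy].
have tP a : t y a \in (C + F y)%VS.
  rewrite memv_add //; first by have [] := cuP a.
  by have [_ _ _ _] := OsP a; apply.
have Mu : M y \in unitmx by rewrite unitmxE unitfE.
apply/eqP; rewrite eqEsubv subvf /= -{1}(span_basis (vbasisP fullv)).
apply/span_subvP => _ /tnthP[l ->]; rewrite (tnth_nth 0).
suff -> : (vbasis {:V})`_l = \sum_a invmx (M y) l a *: t y a.
  by apply: memv_suml => a _; apply: memvZ.
have coefE m : \sum_a invmx (M y) l a * coords (t y a) m = (l == m)%:R.
  have := congr1 (fun A : 'M_n => A l m) (mulVmx Mu); rewrite !mxE => <-.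
  by apply: eq_bigr => a _; rewrite mxE.
transitivity (\sum_m (l == m)%:R *: (vbasis {:V})`_m).
  rewrite (bigD1 l) //= eqxx scale1r big1 ?addr0 // => m ml.
  by rewrite eq_sym (negPf ml) scale0r.
under [RHS]eq_bigr => a _ do rewrite (coords_sum (t y a)) scaler_sumr.
rewrite exchange_big /=; apply: eq_bigr => m _.
under [RHS]eq_bigr => a _ do rewrite scalerA.
by rewrite -scaler_suml coefE.
Qed.

Lemma poly_sections_sum W V (J : finType) (A : {set J}) (X : set W)
    (E : W -> {vspace V}) :
  poly_sections X E ->
  poly_sections [set x : {ffun J -> W} | forall j, X (x j)]
    (fun x => \sum_(j in A) E (x j))%VS.
Proof.
move=> secE x v Xx /memv_sumP[u uE ->].
have /choice[Os OsP] (j : J) : exists Os : set W * (W -> V), j \in A ->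
    [/\ zariski_open Os.1, Os.1 (x j), polymap Os.2, Os.2 (x j) = u j &
        forall y, X y -> Os.1 y -> Os.2 y \in E y].
  case: (boolP (j \in A)) => jA; last by exists (setT, fun=> 0).
  by have [O [s ?]] := secE _ _ (Xx j) (uE _ jA); exists (O, s).
have pr_poly j : polymap (fun y : {ffun J -> W} => y j).
  by apply: polymap_linear => a y z; rewrite !ffunE.
exists [set y : {ffun J -> W} | forall j, j \in A -> (Os j).1 (y j)].
exists (fun y : {ffun J -> W} => \sum_(j in A) (Os j).2 (y j)); split.
- apply: zariski_open_bigI_fin => j.
  case: (boolP (j \in A)) => jA.
    have [Oo _ _ _ _] := OsP j jA.
    have := zariski_open_preimage (pr_poly j) Oo.
    by congr zariski_open; apply/seteqP; split=> y /=; [|apply].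
  by have := zariski_openT {ffun J -> W}; congr zariski_open; apply/seteqP.
- by move=> j jA; have [] := OsP j jA.
- apply: polymap_sum => j jA; have [_ _ sP _ _] := OsP j jA.
  exact: (polymap_comp (pr_poly j) sP).
- by apply: eq_bigr => j jA; have [] := OsP j jA.
move=> y Xy Oy; apply: memv_sumr => j jA.
by have [_ _ _ _] := OsP j jA; apply=> //; apply: Oy.
Qed.

(* Multiplying by the denominators turns the regular section
   [y |-> (phi (y, c)).2] into a polynomial one. *)
Lemma embedded_vector_bundle_sections W V (X : set W) (E : W -> {vspace V}) :
  embedded_vector_bundle X E -> poly_sections X E.
Proof.
move=> EX x v Xx Ev.
have [U [m [phi [psi [Uo Ux [phi_reg _ [phiY psiY] _ phiK] phi1 _]]]]] := EX x Xx.
have XUx : (X `&` U) x by split.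
pose c := (psi (x, v)).2.
(* [psi] keeps the base point because its inverse [phi] does. *)
have psix : psi (x, v) = (x, c).
  have psiXU : (X `&` U) (psi (x, v)).1 by apply: psiY; exists (x, v).
  have := phi1 (psi (x, v)).1 c psiXU; rewrite /c -surjective_pairing phiK // => psi1.
  by rewrite [LHS]surjective_pairing -psi1.
have phixc : phi (x, c) = (x, v) by rewrite -psix phiK.
pose YU : set (W * 'rV[K]_m)%type := [set p | (X `&` U) p.1].
have /choice[r rP] i : exists r : set (W * 'rV[K]_m)%type *
    (mpoly.mpoly (\dim {:(W * 'rV[K]_m)%type}) K *
     mpoly.mpoly (\dim {:(W * 'rV[K]_m)%type}) K),
    [/\ zariski_open r.1, r.1 (x, c) & forall z, YU z -> r.1 z ->
       peval r.2.2 z != 0 /\ coords (phi z) i = peval r.2.1 z / peval r.2.2 z].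
  by have [O [p [q ?]]] := phi_reg i (x, c) XUx; exists (O, (p, q)).
pose p i y := peval (r i).2.1 (y, c); pose q i y := peval (r i).2.2 (y, c).
have slice : polymap (fun y : W => (y, c)).
  apply: (@polymap_affine _ _ _ _ (0, c)) => a y z.
  by congr pair => /=; rewrite ?subr0 // subrr scaler0 addr0.
have pP i : polyfun (p i) := polyfun_comp slice (polyfun_peval _).
have qP i : polyfun (q i) := polyfun_comp slice (polyfun_peval _).
pose D y := \prod_l q l y.
pose b i := ((vbasis {:(W * V)%type})`_i).2 : V.
exists (U `&` [set y | forall i, (r i).1 (y, c)]).
(* This is [D y / D x] times the section: the product [D] clears every denominator, and division by
   the constant [D x] restores the value [v] at [x]. *)
pose s y := \sum_i (p i y * (\prod_(l | l != i) q l y * (D x)^-1)) *: b i.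
exists s.
have sE y : X y -> U y -> (forall i, (r i).1 (y, c)) ->
    s y = (D y / D x) *: (phi (y, c)).2.
  move=> Xy Uy ry; rewrite [phi (y, c)]coords_sum.
  rewrite (big_morph (fun z : W * V => z.2) (id1 := 0) (op1 := +%R)) //.
  rewrite scaler_sumr; apply: eq_bigr => i _; rewrite /= scalerA; congr (_ *: _).
  have [_ _ /(_ (y, c) (conj Xy Uy) (ry i))[qy ->]] := rP i.
  have -> : D y = q i y * \prod_(l | l != i) q l y by rewrite /D (bigD1 i).
  rewrite -/(q i y) -/(p i y).
  rewrite -/(q i y) in qy.
  by rewrite [RHS]mulrC -!mulrA mulKf.
have Dx : D x != 0.
  apply/prodf_neq0 => i _.
  by have [_ rx /(_ (x, c) XUx rx)[]] := rP i.
split.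
- apply: zariski_openI => //; apply: zariski_open_bigI_fin => i.
  by have [ro _ _] := rP i; apply: zariski_open_preimage slice ro.
- by split=> // i; have [] := rP i.
- apply: polymap_sum => i _; apply: polymapZ; apply: polyfunM => //.
  by apply: polyfunM; [apply: polyfun_prod | apply: polyfun_cst].
- rewrite sE //; last by move=> i; have [] := rP i.
  by rewrite phixc divff // scale1r.
move=> y Xy [Uy ry]; rewrite sE //; apply: memvZ.
have : total_space (X `&` U) E (phi (y, c)).
  by apply: phiY; exists (y, c).
by case=> _; rewrite phi1.
Qed.

End PolynomialSections.

(** * Irreducible sets, their products, and general points *)

Section Irreducibility.
Variable K : fieldType.
Implicit Types T U V W : vectType K.

Lemma irreducible_setP T (Z : set T) :
  irreducible_set Z <-> Z !=set0 /\
    forall A B : set T, zariski_open A -> zariski_open B ->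
      Z `&` A !=set0 -> Z `&` B !=set0 -> Z `&` (A `&` B) !=set0.
Proof.
split=> -[Z0 irrZ]; split=> // A B Ao Bo.
  move=> [a [Za Aa]] [b [Zb Bb]]; apply: contrapT => ZAB.
  have [z Zz||] := irrZ (~` A) (~` B) Ao Bo.
  - rewrite -setCI => -[Az Bz]; apply: ZAB; by exists z.
  - by move/(_ a Za); apply.
  - by move/(_ b Zb); apply.
move=> ZAB; apply: contrapT => /not_orP[/existsNP[a /not_implyP[Za Aa]]].
move=> /existsNP[b /not_implyP[Zb Bb]].
have [||||z [Zz [nAz nBz]]] := irrZ (~` A) (~` B).
- by rewrite /zariski_open setCK.
- by rewrite /zariski_open setCK.
- by exists a.
- by exists b.
by case: (ZAB z Zz).
Qed.

Lemma irreducible_image T U (f : T -> U) (Z : set T) :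
  polymap f -> irreducible_set Z -> irreducible_set (f @` Z).
Proof.
move=> fP [[z Zz] irrZ]; split; first by exists (f z), z.
move=> A B Ac Bc ZAB.
have [|||sub|sub] := irrZ (f @^-1` A) (f @^-1` B).
- exact: zariski_closed_preimage.
- exact: zariski_closed_preimage.
- by move=> y Zy; apply: (ZAB (f y)); exists y.
- by left=> _ [y Zy <-]; apply: sub.
- by right=> _ [y Zy <-]; apply: sub.
Qed.

(** The trace on [X] of the closure of [Z] is irreducible, as closed sets containing [Z] contain the
    closure; by maximality it equals [Z]. *)
Lemma irreducible_component_closed T (X Z : set T) :
  irreducible_component X Z -> exists2 A, zariski_closed A & Z = X `&` A.
Proof.
move=> [ZX irrZ maxZ].
pose S : set (mpoly.mpoly (\dim {:T}) K) :=
  [set p | forall z, Z z -> peval p z = 0].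
pose A : set T := [set v | forall p, S p -> peval p v = 0].
have ZA : Z `<=` A by move=> z Zz p Sp; apply: Sp.
have Amin B : zariski_closed B -> Z `<=` B -> A `<=` B.
  by move=> [S' ->] ZB v Av p Sp; apply: Av => z Zz; apply: ZB.
exists A; first by exists S.
symmetry; apply: maxZ; [by move=> x [] | | by move=> z Zz; split; auto].
have [[z Zz] irr] := irrZ.
split; first by exists z; split; auto.
move=> B C Bc Cc XABC; have [|ZB|ZC] := irr B C Bc Cc.
- by move=> y Zy; apply: XABC; split; auto.
- by left=> x [_ Ax]; apply: Amin ZB x Ax.
- by right=> x [_ Ax]; apply: Amin ZC x Ax.
Qed.

Lemma irreducible_component_image T (X Z : set T) (f h : T -> T) :
  polymap f -> polymap h -> cancel f h -> cancel h f ->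
  (forall x, X x -> X (f x)) -> (forall x, X x -> X (h x)) ->
  irreducible_component X Z -> irreducible_component X (f @` Z).
Proof.
move=> fP hP fK hK fX hX [ZX irrZ maxZ]; split.
- by move=> _ [z /ZX Xz <-]; apply: fX.
- exact: irreducible_image.
move=> Z' Z'X irrZ' fZ.
have <- : h @` Z' = Z.
  apply: maxZ; [|exact: irreducible_image|].
    by move=> _ [z /Z'X Xz <-]; apply: hX.
  by move=> z Zz; exists (f z) => //; apply: fZ; exists z.
apply/seteqP; split=> [z Z'z|_ [_ [z Z'z <-] <-]]; last by rewrite hK.
by exists (h z); rewrite ?hK //; exists z.
Qed.

Lemma polymap_patch W (J : finType) (A : {set J}) (x : {ffun J -> W}) :
  polymap (fun y : {ffun J -> W} => [ffun j => if j \in A then y j else x j]).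
Proof.
apply: (@polymap_affine _ _ _ _ [ffun j => if j \in A then 0 else x j]).
move=> a y z; apply/ffunP => j; rewrite !ffunE.
by case: ifP => _; rewrite ?subr0 // subrr scaler0 addr0.
Qed.

Lemma polymap_update W (J : finType) (l : J) (x : {ffun J -> W}) :
  polymap (fun z : W => [ffun j => if j == l then z else x j]).
Proof.
apply: (@polymap_affine _ _ _ _ [ffun j => if j == l then 0 else x j]).
move=> a y z; apply/ffunP => j; rewrite !ffunE.
by case: ifP => _; rewrite ?subr0 // subrr scaler0 addr0.
Qed.

Definition prod_set W (J : finType) (Z : J -> set W) : set {ffun J -> W} :=
  [set x | forall j, Z j (x j)].

(* Two points of open sets are made equal one coordinate at a time, so only
   the continuity of [polymap_update] in each coordinate is used. *)
Lemma irreducible_prod W (J : finType) (Z : J -> set W) :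
  (forall j, irreducible_set (Z j)) -> irreducible_set (prod_set Z).
Proof.
move=> irrZ; apply/irreducible_setP; split.
  have /choice[z zZ] j : exists z, Z j z by case: (irrZ j).
  by exists [ffun j => z j] => j; rewrite ffunE.
move=> A B Ao Bo [a [Za Aa]] [b [Zb Bb]].
suff [x [y [[Zx Ax] [_ By] xy]]] : exists x y,
    [/\ (prod_set Z `&` A) x, (prod_set Z `&` B) y &
        forall j, j \in enum J -> x j = y j].
  exists x; split=> //; split=> //.
  by have -> : x = y by apply/ffunP => j; apply: xy; rewrite mem_enum.
elim: (enum J) => [|l s [x [y [[Zx Ax] [Zy By] xy]]]]; first by exists a, b.
pose u (x : {ffun J -> W}) z : {ffun J -> W} := [ffun j => if j == l then z else x j].
have uid x' : u x' (x' l) = x'.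
  by apply/ffunP => j; rewrite ffunE; case: eqP => [->|].
have /irreducible_setP[_ irr] := irrZ l.
have uo x' O : zariski_open O -> zariski_open (u x' @^-1` O).
  by apply: zariski_open_preimage; apply: polymap_update.
(* The values of coordinate [l] keeping [x] in [A], and those keeping [y] in [B], form open sets
   that meet the irreducible [Z l], so a common value exists. *)
have [||z [Zz [Az Bz]]] := irr _ _ (uo x _ Ao) (uo y _ Bo).
- by exists (x l); split; [exact: Zx | rewrite /preimage /= uid].
- by exists (y l); split; [exact: Zy | rewrite /preimage /= uid].
exists (u x z), (u y z); split.
- by split=> // j; rewrite ffunE; case: eqP => [->|].
- by split=> // j; rewrite ffunE; case: eqP => [->|].
by move=> j; rewrite !ffunE inE; case: eqP => //= _ /xy.
Qed.

(* For irreducible [Z] this is [for_general Z P]: there a nonempty relatively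
   open set is dense. *)
Definition generally T (Z : set T) (P : T -> Prop) : Prop :=
  exists O, [/\ zariski_open O, Z `&` O !=set0 & forall z, Z z -> O z -> P z].

Lemma generallyW T (Z : set T) (P Q : T -> Prop) :
  (forall z, Z z -> P z -> Q z) -> generally Z P -> generally Z Q.
Proof.
move=> PQ [O [Oo ZO OP]]; exists O; split=> // z Zz Oz.
by apply: PQ => //; apply: OP.
Qed.

Lemma generally_ex T (Z : set T) (P : T -> Prop) :
  generally Z P -> exists2 z, Z z & P z.
Proof. by move=> [O [_ [z [Zz Oz]] OP]]; exists z; auto. Qed.

Lemma generallyT T (Z : set T) (P : T -> Prop) :
  Z !=set0 -> (forall z, Z z -> P z) -> generally Z P.
Proof.
move=> [z Zz] PZ; exists setT; split; [exact: zariski_openT | by exists z |].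
by move=> y Zy _; apply: PZ.
Qed.

Lemma generallyI T (Z : set T) (P Q : T -> Prop) :
  irreducible_set Z -> generally Z P -> generally Z Q ->
  generally Z (fun z => P z /\ Q z).
Proof.
move=> /irreducible_setP[_ irrZ] [O [Oo ZO OP]] [O' [O'o ZO' O'Q]].
exists (O `&` O'); split; [exact: zariski_openI | exact: irrZ |].
by move=> z Zz [Oz O'z]; split; auto.
Qed.

Lemma generally_forall T (Z : set T) (I : finType) (P : I -> T -> Prop) :
  irreducible_set Z -> (forall i, generally Z (P i)) ->
  generally Z (fun z => forall i, P i z).
Proof.
move=> irrZ gP; suff : generally Z (fun z => forall i, i \in enum I -> P i z).
  by apply: generallyW => z _ zP i; apply: zP; rewrite mem_enum.
elim: (enum I) => [|i s IH]; first by apply: generallyT => //; case: irrZ.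
apply: generallyW (generallyI irrZ (gP i) IH) => z _ [Pz sz] l.
by rewrite inE => /predU1P[->|/sz].
Qed.

Lemma generally_preimage T (Z : set T) (P : T -> Prop) (f : T -> T) :
  polymap f -> (forall z, Z z -> Z (f z)) ->
  (forall z, Z z -> exists2 y, Z y & f y = z) ->
  generally Z P -> generally Z (P \o f).
Proof.
move=> fP fZ fsurj [O [Oo [z [Zz Oz]] OP]]; exists (f @^-1` O); split.
- exact: zariski_open_preimage.
- by have [y Zy fy] := fsurj z Zz; exists y; split=> //=; rewrite /preimage /= fy.
by move=> y Zy Oy; apply: OP => //; apply: fZ.
Qed.

(** A subspace of maximal dimension among those inside [S] absorbs every vector of [S], since
    adjoining one stays inside [S]. *)
Lemma exists_vspace V (S : V -> Prop) :
  S 0 -> (forall a u v, S u -> S v -> S (a *: u + v)) ->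
  exists U : {vspace V}, forall v, v \in U <-> S v.
Proof.
move=> S0 Slin.
pose good d := `[<exists U : {vspace V}, (forall v, v \in U -> S v) /\ \dim U = d>].
have good0 : exists d, good d.
  exists 0%N; apply/asboolP; exists 0%VS; split; last exact: dimv0.
  by move=> v; rewrite memv0 => /eqP ->.
have goodb d : good d -> (d <= \dim {:V})%N.
  by move=> /asboolP[U [_ <-]]; rewrite dimvS ?subvf.
case: (ex_maxnP good0 goodb) => d /asboolP[U [US dU]] maxd.
exists U => v; split; first exact: US.
move=> Sv; have : good (\dim (<[v]> + U)).
  apply/asboolP; exists (<[v]> + U)%VS; split=> // w.
  by case/memv_addP=> _ /vlineP[a ->] [u /US Su ->]; apply: Slin.
move=> /maxd; rewrite -dU => le.
have /eqP -> : U == (<[v]> + U)%VS.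
  by rewrite -(dimv_leqif_eq (addvSr _ _)) eqn_leq le dimvS ?addvSr.
by rewrite (subvP (addvSl _ _)) // memv_line.
Qed.

End Irreducibility.

(** * Dimensions of spans and intersections for general families of points *)

Section GenericSpans.
Variables (K : fieldType) (W V : vectType K) (I : finType) (M : nat).
Variables (X : set W) (E : W -> {vspace V}) (Xc : I -> set W) (N : I -> nat).
Hypothesis secE : poly_sections X E.
Hypothesis XcX : forall i, Xc i `<=` X.
Hypothesis irrXc : forall i, irreducible_set (Xc i).
Hypothesis dimE : forall i x, Xc i x -> \dim (E x) = N i.

Local Notation J := (I * 'I_M)%type.
Implicit Types (A B : {set J}) (j l : J) (x y : {ffun J -> W}).

Definition points : set {ffun J -> W} := prod_set (fun j : J => Xc j.1).

Definition espan A x : {vspace V} := (\sum_(j in A) E (x j))%VS.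

Definition mrank A : nat :=
  (\max_(d < (\dim {:V}).+1 | `[<exists2 x, points x & \dim (espan A x) = d>]) d)%N.

Lemma irreducible_points : irreducible_set points.
Proof. by apply: irreducible_prod => j; apply: irrXc. Qed.

Lemma le_mrank A x : points x -> (\dim (espan A x) <= mrank A)%N.
Proof.
move=> Zx; have lt : (\dim (espan A x) < (\dim {:V}).+1)%N by rewrite ltnS dimvS ?subvf.
by apply: (bigop.bigmax_sup (Ordinal lt)) => //; apply/asboolP; exists x.
Qed.

Lemma mrank_attained A : exists2 x, points x & \dim (espan A x) = mrank A.
Proof.
have [x Zx] : points !=set0 by case: irreducible_points.
have lt : (\dim (espan A x) < (\dim {:V}).+1)%N by rewrite ltnS dimvS ?subvf.
pose P (d : 'I_(\dim {:V}).+1) := `[<exists2 x, points x & \dim (espan A x) = d>].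
have Plt : P (Ordinal lt) by apply/asboolP; exists x.
have [|d /asboolP[y Zy dy] dm] := @bigop.eq_bigmax_cond _ P (fun d => d : nat).
  by apply/card_gt0P; exists (Ordinal lt).
by exists y => //; rewrite dy -dm.
Qed.

Lemma espan_leS A B x : A \subset B -> (espan A x <= espan B x)%VS.
Proof.
move=> /fintype.subsetP AB; apply/subv_sumP => j jA.
exact: (sumv_sup j (AB j jA)).
Qed.

Lemma espanU1 A j x : j \notin A -> espan (j |: A)%SET x = (E (x j) + espan A x)%VS.
Proof. by move=> jA; rewrite /espan big_setU1. Qed.

Lemma points_sub x j : points x -> X (x j).
Proof. by move=> Zx; apply: XcX (Zx j). Qed.

Definition good x : Prop := points x /\ forall A, \dim (espan A x) = mrank A.

(** For each [A], a complement of a span of maximal dimension still fills [V] together with the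
    nearby spans, so these have maximal dimension too. The finitely many open conditions are then
    combined by irreducibility. *)
Lemma generally_good : generally points good.
Proof.
suff : generally points (fun x => forall A, \dim (espan A x) = mrank A).
  by apply: generallyW.
apply: generally_forall => [|A]; first exact: irreducible_points.
have [x Zx rx] := mrank_attained A.
have secA : poly_sections points (espan A).
  move=> y v Zy Av; have Xy : [set x : {ffun J -> W} | forall j, X (x j)] y.
    by move=> j; apply: points_sub.
  have [O [s [Oo Oy sP sy sO]]] := poly_sections_sum secE Xy Av.
  exists O, s; split=> // z Zz Oz; apply: sO => // j.
  exact: points_sub.
have full : ((espan A x)^C + espan A x)%VS = fullv by rewrite addvC addv_complf.
have [O [Oo Ox Ofull]] := poly_sections_full secA Zx full.
exists O; split=> //; first by exists x.
move=> y Zy Oy; apply/eqP; rewrite eqn_leq le_mrank //= -rx.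
have := (dimv_add_leqif (espan A x)^C (espan A y)).1.
rewrite Ofull // dimv_compl => le.
rewrite -(leq_add2l (\dim {:V} - \dim (espan A x))).
by rewrite subnK // dimvS ?subvf.
Qed.

Definition fib A i : {set J} := [set j in A | j.1 == i]%SET.

Definition ctype A i : nat := #|fib A i|.

Lemma ctypeU1 A j i : j \notin A -> ctype (j |: A)%SET i = ((j.1 == i) + ctype A i)%N.
Proof.
move=> jA; rewrite /ctype; case: (eqVneq j.1 i) => ji.
  have -> : fib (j |: A)%SET i = (j |: fib A i)%SET.
    apply/setP => l; rewrite !inE; case: (eqVneq l j) => //= -> .
    by rewrite ji eqxx.
  by rewrite cardsU1 !inE (negPf jA).
congr #|pred_of_set _|; apply/setP => l; rewrite !inE.
by case: (eqVneq l j) => //= ->; rewrite (negPf ji) andbF.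
Qed.

Lemma ctype_exchange A B b : ctype A =1 ctype B -> b \in B -> b \notin A ->
  exists a, [/\ a \in A, a \notin B & a.1 = b.1].
Proof.
move=> AB bB bA; apply: contrapT => noa.
suff : (ctype A b.1 < ctype B b.1)%N by rewrite AB ltnn.
apply: proper_card; apply/fintype.properP; split; last first.
  by exists b; rewrite !inE ?bB ?eqxx // (negPf bA).
apply/fintype.subsetP => a; rewrite !inE => /andP[aA /eqP ab].
rewrite ab eqxx andbT; apply: contrapT => /negP aB.
by apply: noa; exists a.
Qed.

Lemma mrank_ctype_le A B : (forall i, (ctype A i <= ctype B i)%N) ->
  (mrank A <= mrank B)%N.
Proof.
move=> AB.
(* [h] matches the [m]-th index of [B] in a component with the [m]-th index of [A] there. The
   default [j] keeps the component, so that [x] composed with [h] is again a family in [points]. *)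
pose h j := nth j (enum (fib A j.1)) (index j (enum (fib B j.1))).
have h1 j : (h j).1 = j.1.
  rewrite /h; set s := enum _; set m := index _ _.
  have [ms|ms] := ltnP m (size s); last by rewrite nth_default.
  by have := mem_nth j ms; rewrite mem_enum !inE => /andP[_ /eqP].
have hB a : a \in A -> exists2 b, b \in B & h b = a.
  move=> aA; have aF : a \in enum (fib A a.1) by rewrite mem_enum !inE aA eqxx.
  have lt : (index a (enum (fib A a.1)) < size (enum (fib B a.1)))%N.
    by rewrite -cardE (leq_trans _ (AB a.1)) // /ctype cardE index_mem.
  have := mem_nth a lt; set b := nth _ _ _; rewrite mem_enum !inE.
  move=> /andP[bB /eqP ba]; exists b => //.
  by rewrite /h ba index_uniq ?enum_uniq // nth_index.
have [x Zx <-] := mrank_attained A.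
pose y : {ffun J -> W} := [ffun j => x (h j)].
have Zy : points y by move=> j; rewrite ffunE -h1; apply: Zx.
apply: leq_trans (le_mrank B Zy); apply: dimvS.
apply/subv_sumP => a /hB[b bB hba].
by apply: (sumv_sup b) => //; rewrite ffunE hba.
Qed.

Lemma mrank_ctype A B : ctype A =1 ctype B -> mrank A = mrank B.
Proof. by move=> AB; apply/eqP; rewrite eqn_leq !mrank_ctype_le // => i; rewrite AB. Qed.

Definition capd j A x : nat := \dim (E (x j) :&: espan A x)%VS.

Lemma capdE j A x : good x -> j \notin A ->
  (mrank (j |: A)%SET + capd j A x)%N = (N j.1 + mrank A)%N.
Proof.
move=> [Zx rx] jA; rewrite -!rx espanU1 // dimv_sum_cap.
by rewrite (dimE (Zx j)).
Qed.

(** By [capdE] the intersection dimension is a combination of maximal ranks, and these depend only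
    on types; thus even different good families can be compared. *)
Lemma capd_ctype j l A B x y : good x -> good y -> j \notin A -> l \notin B ->
  j.1 = l.1 -> ctype A =1 ctype B -> capd j A x = capd l B y.
Proof.
move=> gx gy jA lB jl AB; apply/eqP.
rewrite -(eqn_add2l (mrank (j |: A)%SET)) capdE //.
rewrite (@mrank_ctype (j |: A) (l |: B))%SET; last first.
  by move=> i; rewrite !ctypeU1 // jl AB.
by rewrite capdE // jl (mrank_ctype AB).
Qed.

Lemma capd_leS j A B x : A \subset B -> (capd j A x <= capd j B x)%N.
Proof. by move=> AB; apply/dimvS/capvS => //; apply: espan_leS. Qed.

(* If enlarging [A] by one point of each component does not enlarge the
   intersection with [E (x j)], then replacing a single point of [A] does not
   change it either, hence it does not depend on the points of [A] at all. *)
Lemma cap_exchange j A A' B x : good x -> A \subset A' -> j \notin A' ->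
  (forall i, exists l, [/\ l \in A', l \notin A & l.1 = i]) ->
  capd j A x = capd j A' x -> j \notin B -> ctype B =1 ctype A ->
  (E (x j) :&: espan B x = E (x j) :&: espan A x)%VS.
Proof.
move=> gx AA' jA' newA cAA'.
have jA : j \notin A by apply: contra jA'; apply: (fintype.subsetP AA').
(* By types, the two dimensions are those for [A] and for [l |: A] with [l] in [A'] from the
   component of [z]; the latter is squeezed between those for [A] and [A'], which agree. *)
have capU1 B' z : j \notin B' -> ctype B' =1 ctype A -> z \notin B' -> z != j ->
    (E (x j) :&: espan B' x = E (x j) :&: espan (z |: B')%SET x)%VS.
  move=> jB' B'A zB' zj; apply/eqP; rewrite -dimv_leqif_eq; last first.
    by apply: capvS => //; apply: espan_leS; apply: finset.subsetUr.
  have [l [lA' lA lz]] := newA z.1.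
  apply/eqP; apply/anti_leq; rewrite -!/(capd _ _ _) capd_leS ?finset.subsetUr //=.
  rewrite (@capd_ctype j j B' A x x) //.
  have jl : j != l by apply: contra jA' => /eqP ->.
  rewrite (@capd_ctype j j (z |: B')%SET (l |: A)%SET x x) //.
  - rewrite cAA'; apply: capd_leS.
    by rewrite finset.subUset finset.sub1set lA' AA'.
  - by rewrite !inE negb_or eq_sym zj jB'.
  - by rewrite !inE negb_or jl jA.
  - by move=> i; rewrite !ctypeU1 // lz B'A.
have [m] := ubnP #|B :\: A|; elim: m B => // m IH B; rewrite ltnS => leB jB BA.
case: (set_0Vmem (B :\: A)%SET) => [BA0|[b]].
  suff -> : B = A by [].
  apply/eqP; rewrite finset.eqEsubset -finset.setD_eq0 BA0 eqxx /=.
  apply/fintype.subsetP => a aA; apply: contrapT => /negP aB.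
  have [b [bB bA _]] := ctype_exchange BA aA aB.
  by have := finset.in_set0 b; rewrite -BA0 !inE bB bA.
rewrite !inE => /andP[bA bB].
have [a [aA aB ab]] := ctype_exchange (fsym BA) bB bA.
have aj : a != j by apply: contra jA => /eqP <-.
have aBb : a \notin (B :\ b)%SET by rewrite !inE (negPf aB) andbF.
(* [B'] trades [b] for [a] and is one step closer to [A]. The intersections for [B] and [B'] both
   lie in the one for [a |: B] and have its dimension. *)
pose B' := (a |: B :\ b)%SET.
have jB' : j \notin B' by rewrite !inE eq_sym (negPf aj) (negPf jB) andbF.
have B'A : ctype B' =1 ctype A.
  move=> i; rewrite ctypeU1 // -BA -[in RHS](finset.setD1K bB) ctypeU1 ?ab //.
  by rewrite !inE eqxx.
rewrite -(IH B') //; last first.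
  apply: leq_trans leB; apply: proper_card; apply/fintype.properP; split.
    apply/fintype.subsetP => l; rewrite !inE => /andP[lA].
    by case/orP=> [/eqP la|/andP[_ ->]]; [rewrite la aA in lA|rewrite lA].
  by exists b; rewrite !inE ?bA ?bB // eqxx; case: (eqVneq b a) => //= ba;
     rewrite ba aA in bA.
rewrite (capU1 B a) //; apply/eqP; rewrite eq_sym.
have sub : (E (x j) :&: espan B' x <= E (x j) :&: espan (a |: B)%SET x)%VS.
  by apply: capvS => //; apply: espan_leS; apply: finset.setUS; apply: finset.subD1set.
rewrite -(dimv_leqif_eq sub) -(capU1 B a) //.
by rewrite -/(capd j B' x) -/(capd j B x) (@capd_ctype j j B' B x x) // => i; rewrite B'A BA.
Qed.

(** The span over [A] ignores the coordinates outside [A], so these may be reset to those of [x];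
    the required open set is the preimage of [O] under this substitution. *)
Lemma generally_mem_espan (O : set {ffun J -> W}) A x v :
  zariski_open O -> points x -> O x ->
  (forall y, points y -> O y -> (forall j, j \notin A -> y j = x j) ->
     v \in espan A y) ->
  generally points (fun y => v \in espan A y).
Proof.
move=> Oo Zx Ox vA.
pose p (y : {ffun J -> W}) : {ffun J -> W} := [ffun j => if j \in A then y j else x j].
exists (p @^-1` O); split.
- exact: zariski_open_preimage (polymap_patch A x) Oo.
- exists x; split=> //; rewrite /preimage /=.
  by have -> : p x = x by apply/ffunP => j; rewrite ffunE; case: ifP.
move=> y Zy Opy; have -> : espan A y = espan A (p y).
  by apply: eq_bigr => j jA; rewrite ffunE jA.
apply: vA => // [j|j jA]; rewrite ffunE; last by rewrite (negPf jA).
by case: ifP => _; [apply: Zy | apply: Zx].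
Qed.

End GenericSpans.

(** * Using the irreducibility of the module *)

Section InvariantSpans.
Variables (G : groupType) (K : fieldType) (W V : vectType K).
Variables (rhoW : gmodule G W) (rhoV : gmodule G V).

Lemma gmoduleK (U : vectType K) (rho : gmodule G U) g : cancel (rho g) (rho g^-1%g).
Proof.
by move=> u; rewrite -comp_lfunE -gactM mulVg gact1 id_lfunE.
Qed.

Lemma gmoduleVK (U : vectType K) (rho : gmodule G U) g : cancel (rho g^-1%g) (rho g).
Proof.
by move=> u; rewrite -comp_lfunE -gactM mulgV gact1 id_lfunE.
Qed.

Variables (I : finType) (M : nat).
Variables (X : set W) (E : W -> {vspace V}) (Xc : I -> set W) (gamma : I -> nat).
Hypothesis V_irreducible : irreducible_gmodule rhoV.
Hypothesis E_invariant : invariant_bundle rhoW rhoV X E.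
Hypothesis XcX : forall i, Xc i `<=` X.
Hypothesis irrXc : forall i, irreducible_set (Xc i).
Hypothesis Xc_inj : injective Xc.
Hypothesis Xc_perm : forall g i, exists i', rhoW g @` Xc i = Xc i'.
Hypothesis gamma_orbits : forall g i i', rhoW g @` Xc i = Xc i' -> gamma i = gamma i'.

Local Notation J := (I * 'I_M)%type.

Definition block : {set J} := [set j : J | (j.2 < gamma j.1)%N]%SET.

(* The vectors lying in a general span form a submodule. *)
Lemma generic_espan_full v : v != 0 ->
  generally (points (M := M) Xc) (fun x => v \in espan E block x) ->
  exists2 x, points (M := M) Xc x & espan E block x = fullv.
Proof.
move=> v0 vgen; pose Z := points (M := M) Xc.
have irrZ : irreducible_set Z by apply: irreducible_points.
have [|a u w Su Sw|U US] :=
    @exists_vspace _ _ (fun u => generally Z (fun x => u \in espan E block x)).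
- by apply: generallyT => [|x _]; [case: irrZ | apply: mem0v].
- by apply: generallyW (generallyI irrZ Su Sw) => x _ [ux wx]; rewrite memvD ?memvZ.
have [_ irrV] := V_irreducible.
have [|U0|Ufull] := irrV U.
- move=> g; apply/subvP => _ /memv_imgP[u /US ugen ->]; apply/US.
  have [s sP] := choice (Xc_perm g); have [t tP] := choice (Xc_perm g^-1%g).
  have ts i : t (s i) = i.
    apply: Xc_inj; rewrite -tP -sP; apply/seteqP; split.
      by move=> _ [_ [z Xz <-] <-]; rewrite gmoduleK.
    by move=> z Xz; exists (rhoW g z); rewrite ?gmoduleK //; exists z.
  (* With [s] the permutation of components induced by [g], [f] applies the inverse of [g] to a
     family and reindexes it so that each point lies in its prescribed component. If [u] lies in the
     span of [f x], then [rhoV g u] lies in that of [x]. *)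
  pose f (x : {ffun J -> W}) : {ffun J -> W} :=
    [ffun j => rhoW g^-1%g (x (s j.1, j.2))].
  have fP : polymap f.
    by apply: polymap_linear => a x y; apply/ffunP => j; rewrite !ffunE linearP.
  have fZ x : Z x -> Z (f x).
    move=> Zx j; rewrite ffunE; have /= := Zx (s j.1, j.2); rewrite -sP.
    by case=> z Xz <-; rewrite gmoduleK.
  have fsurj x : Z x -> exists2 y, Z y & f y = x.
    move=> Zx; exists [ffun j => rhoW g (x (t j.1, j.2))].
      move=> j; rewrite ffunE.
      have -> : Xc j.1 = rhoW g @` Xc (t j.1).
        apply/seteqP; rewrite -tP; split=> [z Xz|_ [_ [z Xz <-] <-]].
          by exists (rhoW g^-1%g z); rewrite ?gmoduleVK //; exists z.
        by rewrite gmoduleVK.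
      by exists (x (t j.1, j.2)) => //; apply: Zx (t j.1, j.2).
    by apply/ffunP => -[i a]; rewrite !ffunE /= ts gmoduleK.
  apply: generallyW (generally_preimage fP fZ fsurj ugen) => x Zx /=.
  move=> /(memv_img (rhoV g)); apply: subvP; rewrite /espan limg_sum.
  apply/subv_sumP => j jA; apply: (sumv_sup (s j.1, j.2)).
    by move: jA; rewrite !inE /= -(gamma_orbits (sP j.1)).
  have Xx : X (x (s j.1, j.2)) := XcX (Zx (s j.1, j.2)).
  rewrite ffunE E_invariant // -limg_comp -gactM mulgV gact1.
  by apply/subvP => _ /memv_imgP[w Ew ->]; rewrite id_lfunE.
- by have := (US v).2 vgen; rewrite U0 memv0 (negPf v0).
(* Finitely many general conditions, one per basis vector, hold at a common family. *)
have [x Zx xP] : exists2 x, Z x & forall a : 'I_(\dim {:V}), (vbasis {:V})`_a \in espan E block x.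
  apply: generally_ex; apply: generally_forall => // a.
  by apply/US; rewrite Ufull memvf.
exists x => //; apply/eqP; rewrite eqEsubv subvf /= -{1}(span_basis (vbasisP fullv)).
by apply/span_subvP => _ /tnthP[a ->]; rewrite (tnth_nth 0).
Qed.

End InvariantSpans.

(** * Growth of the intersections and existence of a spanning family *)

Section FullSpan.
Variables (G : groupType) (K : fieldType) (W V : vectType K).
Variables (rhoW : gmodule G W) (rhoV : gmodule G V) (I : finType).
Variables (X : set W) (E : W -> {vspace V}) (Xc : I -> set W) (N alpha : I -> nat).
Hypothesis secE : poly_sections X E.
Hypothesis V_irreducible : irreducible_gmodule rhoV.
Hypothesis E_invariant : invariant_bundle rhoW rhoV X E.
Hypothesis XcX : forall i, Xc i `<=` X.
Hypothesis irrXc : forall i, irreducible_set (Xc i).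
Hypothesis Xc_inj : injective Xc.
Hypothesis Xc_perm : forall g i, exists i', rhoW g @` Xc i = Xc i'.
Hypothesis alpha_orbits :
  forall g i i', rhoW g @` Xc i = Xc i' -> alpha i = alpha i'.
Hypothesis dimE : forall i x, Xc i x -> \dim (E x) = N i.

Lemma ctype_interval m lo (gamma : I -> nat) i :
  (forall i, lo + gamma i <= m.+1)%N ->
  ctype [set j : I * 'I_m.+1 | (lo <= j.2 < lo + gamma j.1)%N]%SET i = gamma i.
Proof.
move=> le_m; pose f (a : 'I_(gamma i)) : I * 'I_m.+1 := (i, inord (lo + a)).
have fE (a : 'I_(gamma i)) : (inord (lo + a) : 'I_m.+1) = (lo + a)%N :> nat.
  by rewrite inordK // (leq_trans _ (le_m i)) // ltn_add2l ltn_ord.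
have f_inj : injective f.
  by move=> a b [] /(congr1 val); rewrite /= !fE => /addnI /val_inj.
rewrite -[RHS]card_ord -cardsT -(card_imset _ f_inj); congr #|pred_of_set _|.
apply/setP => -[i' b]; rewrite !inE /=; apply/andP/imsetP.
  move=> [/andP[lob bg] /eqP ii']; rewrite ii' in bg *.
  have lt : (b - lo < gamma i)%N by rewrite ltn_subLR.
  exists (Ordinal lt) => //; congr pair; apply: val_inj.
  by rewrite /= (fE (Ordinal lt)) /= subnKC.
by move=> [a _ [-> ->]]; rewrite fE leq_addr ltn_add2l ltn_ord eqxx.
Qed.

(** A fiber in the family meets the span of the others in the same dimension as the fresh fiber of
    its component does, which is zero. So the sum is direct and has the expected dimension. *)
Lemma dim_espan_independent m (A : {set I * 'I_m}) (x : {ffun I * 'I_m -> W})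
    (l : I -> I * 'I_m) :
  good E Xc x -> (forall i, (l i).1 = i) -> (forall i, l i \notin A) ->
  (forall i, capd E (l i) A x = 0%N) ->
  (\sum_i ctype A i * N i <= \dim {:V})%N.
Proof.
move=> gx l1 lA cl0.
have /directvP /= dim_sum : directv (\sum_(j in A) E (x j))%VS.
  apply/directv_sumP => j jA; apply/eqP; rewrite -dimv_eq0.
  have jAj : j \notin (A :\ j)%SET by rewrite !inE eqxx.
  have -> : (\sum_(i in A | i != j) E (x i))%VS = espan E (A :\ j)%SET x.
    by apply: eq_bigl => i; rewrite !inE andbC.
  have lAj : l j.1 \notin (A :\ j)%SET by rewrite !inE negb_and lA orbT.
  rewrite -/(capd E j _ x) (capd_ctype irrXc dimE gx gx jAj lAj) //.
  by rewrite -leqn0 -(cl0 j.1); apply: capd_leS; apply: finset.subD1set.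
have -> : (\sum_i ctype A i * N i = \sum_(j in A) \dim (E (x j)))%N.
  rewrite (partition_big fst xpredT) //=; apply: eq_bigr => i _.
  rewrite (eq_bigr (fun=> N i)) => [|j /andP[_ /eqP ji]]; last first.
    by have [Zx _] := gx; rewrite -ji; apply: dimE (Zx j).
  by rewrite sum_nat_const; congr (_ * _)%N; apply: eq_card => j; rewrite !inE.
by rewrite -dim_sum dimvS ?subvf.
Qed.

(* [gamma 0] has expected dimension exceeding [dim V], so a general fiber meets
   the corresponding span. Each further round of one point per component
   enlarges this intersection, and after [r] rounds it is the whole fiber. *)
Lemma full_block n r : (forall i, alpha i <= n)%N -> (forall i, N i <= r.+1)%N ->
  (forall i, r < alpha i)%N ->
  (\dim {:V} + r * \sum_i N i < \sum_i alpha i * N i)%N ->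
  exists2 x, points (M := (n + n).+1) Xc x & espan E (block _ alpha) x = fullv.
Proof.
(* Each component gets [n] indices for the blocks [A t], [n] more for a disjoint copy [B], and a
   last one, [l i], for a fresh point. *)
move=> alpha_n N_r r_alpha sum_lt; pose M := (n + n).+1.
pose gamma t i := (alpha i - r + t)%N.
pose A t : {set I * 'I_M} := block M (gamma t).
have gamma_r i : gamma r i = alpha i by rewrite /gamma subnK // ltnW.
have Ar : A r = block M alpha by apply/setP => j; rewrite !inE gamma_r.
have AS t t' : (t <= t')%N -> A t \subset A t'.
  move=> tt'; apply/fintype.subsetP => j; rewrite !inE => /leq_trans; apply.
  by rewrite leq_add2l.
have gamma_n t i : (t <= r)%N -> (gamma t i <= n)%N.
  by move=> tr; rewrite (leq_trans _ (alpha_n i)) // -gamma_r leq_add2l.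
apply: contrapT => notfull.
have [O [Oo [x [Zx Ox]] Ogood]] := generally_good M secE XcX irrXc.
have gx := Ogood x Zx Ox.
have not_generic t v : (t <= r)%N -> v != 0 ->
    ~ generally (points (M := M) Xc) (fun y => v \in espan E (A t) y).
  move=> tr v0 vgen; apply: notfull.
  have gamma_orbits g i i' : rhoW g @` Xc i = Xc i' -> gamma t i = gamma t i'.
    by rewrite /gamma => /alpha_orbits ->.
  have [y Zy full_y] := generic_espan_full V_irreducible E_invariant XcX irrXc
    Xc_inj Xc_perm gamma_orbits v0 vgen.
  exists y => //; apply/eqP; rewrite eqEsubv subvf /= -full_y -Ar.
  by apply: espan_leS; apply: AS.
have ctypeA t i : (t <= r)%N -> ctype (A t) i = gamma t i.
  move=> tr; rewrite -(@ctype_interval (n + n) 0 (gamma t)) => [|i'].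
    by congr ctype; apply/setP => j; rewrite !inE.
  by rewrite add0n (leq_trans (gamma_n t i' tr)) // -addSn leq_addl.
pose l i : I * 'I_M := (i, ord_max).
have lA t i : (t <= r)%N -> l i \notin A t.
  move=> tr; rewrite inE /= -leqNgt (leq_trans (gamma_n t i tr)) //.
  exact: leq_addr.
(* Otherwise the fibers over [A 0] are independent, and their total dimension
   [\sum_i (alpha i - r) * N i] exceeds that of [V]. *)
have [i0 c0] : exists i, (0 < capd E (l i) (A 0) x)%N.
  apply: contrapT => noc.
  have sumE : (\sum_i ctype (A 0) i * N i + r * \sum_i N i = \sum_i alpha i * N i)%N.
    rewrite big_distrr -big_split /=; apply: eq_bigr => i _.
    by rewrite ctypeA // -mulnDl /gamma addn0 subnK // ltnW.
  move: sum_lt; rewrite -sumE ltn_add2r ltnNge => /negP; apply.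
  apply: (dim_espan_independent gx (l := l)) => // i; first exact: lA.
  by apply/eqP; rewrite -leqn0 leqNgt; apply/negP => ci; apply: noc; exists i.
have c_gt t : (t <= r)%N -> (t < capd E (l i0) (A t) x)%N.
  elim: t => // t IH lt_tr; have tr := ltnW lt_tr.
  apply: leq_ltn_trans (IH tr) _; rewrite ltn_neqAle capd_leS ?AS // andbT.
  apply/eqP => ceq.
  (* A copy of the type of [A t] that avoids both [A t] and [l i0]. If the intersection did not
     grow, [cap_exchange] would make it the same for [A t] and [B]. *)
  pose B := [set j : I * 'I_M | (n <= j.2 < n + gamma t j.1)%N]%SET.
  have BA : ctype B =1 ctype (A t).
    move=> i; rewrite ctypeA // ctype_interval // => i'.
    by rewrite -addnS leq_add2l ltnW // ltnS gamma_n.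
  have lB : l i0 \notin B.
    rewrite inE /= negb_and -leqNgt; apply/orP; right.
    by rewrite leq_add2l gamma_n.
  have newA i : exists j, [/\ j \in A t.+1, j \notin A t & j.1 = i].
    have lt : (gamma t i < M)%N by rewrite ltnS (leq_trans (gamma_n t i tr)) ?leq_addr.
    by exists (i, Ordinal lt); rewrite !inE /= ltnn /gamma addnS ltnSn.
  have capB y : good E Xc y ->
      (E (y (l i0)) :&: espan E B y = E (y (l i0)) :&: espan E (A t) y)%VS.
    move=> gy; apply: (cap_exchange irrXc dimE gy (AS _ _ (leqnSn t))) => //.
      exact: lA.
    rewrite (capd_ctype irrXc dimE gy gx (lA t i0 tr) (lA t i0 tr)) //.
    by rewrite ceq; apply: (capd_ctype irrXc dimE gx gy); rewrite ?lA.
  have : (E (x (l i0)) :&: espan E B x)%VS != 0%VS.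
    by rewrite capB // -dimv_eq0 -lt0n; apply: leq_ltn_trans (IH tr).
  (* This [v] depends only on points outside [A t]. Freezing them while the points of [A t] vary
     keeps [v] in the intersection, hence in the general span over [A t]. *)
  rewrite -vpick0; set v := vpick _ => v0; apply: (not_generic t v tr v0).
  apply: (generally_mem_espan Oo Zx Ox) => y Zy Oy yx.
  have /subvP := capvSr (E (y (l i0))) (espan E (A t) y); apply.
  rewrite -(capB y (Ogood y Zy Oy)).
  have -> : espan E B y = espan E B x.
    apply: eq_bigr => j; rewrite !inE => /andP[nj _]; rewrite yx // inE -leqNgt.
    by apply: leq_trans nj; apply: gamma_n.
  by rewrite yx ?lA // memv_pick.
have Esub y : good E Xc y -> (E (y (l i0)) <= espan E (A r) y)%VS.
  move=> gy; apply/capv_idPl/eqP; rewrite -(dimv_leqif_eq (capvSl _ _)).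
  rewrite eqn_leq dimvS ?capvSl //=.
  rewrite -/(capd E (l i0) (A r) y).
  rewrite (capd_ctype irrXc dimE gy gx (lA r i0 (leqnn r)) (lA r i0 (leqnn r))) //.
  by rewrite (dimE (gy.1 (l i0))) (leq_trans (N_r _)) // c_gt.
have : E (x (l i0)) != 0%VS.
  rewrite -dimv_eq0 -lt0n; apply: leq_trans c0 _.
  by apply: dimvS; apply: capvSl.
(* The same freezing argument, now with [v] taken from the whole fiber at the fresh point [l i0]. *)
rewrite -vpick0; set v := vpick _ => v0; apply: (not_generic r v (leqnn r) v0).
apply: (generally_mem_espan Oo Zx Ox) => y Zy Oy yx.
have /subvP := Esub y (Ogood y Zy Oy); apply.
by rewrite yx ?lA // memv_pick.
Qed.

End FullSpan.

(** * Component indices of a sequence of given type *)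

(** Double counting: each element of [J] contributes at most one to the sum, so an element
    contributing nothing would make the sum smaller than [#|J|]. *)
Lemma exists_of_unique_count (I J : finType) (P : J -> pred I) :
  (forall j i i', P j i -> P j i' -> i = i') ->
  (#|J| <= \sum_i #|[pred j | P j i]|)%N -> forall j, exists i, P j i.
Proof.
move=> uniqP le j; apply: contrapT => noc.
have : (\sum_i #|[pred j | P j i]| <= #|[pred l | l != j]|)%N.
  rewrite -[leqRHS]sum1_card (eq_bigr (fun i => \sum_l (P l i : nat))%N); last first.
    move=> i _; rewrite -sum1_card big_mkcond; apply: eq_bigr => l _.
    by rewrite inE; case: (P l i).
  rewrite exchange_big /= [leqRHS]big_mkcond; apply: leq_sum => l _ /=.
  rewrite inE; case: (pselect (exists i, P l i)) => [[i Pi]|noi]; last first.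
    by rewrite big1 // => i _; case: (boolP (P l i)) => // Pi; case: noi; exists i.
  have -> : l != j by apply/eqP => lj; apply: noc; exists i; rewrite -lj.
  rewrite (bigD1 i) //= Pi big1 // => i' ii'.
  by case: (boolP (P l i')) => // Pi'; rewrite (uniqP _ _ _ Pi Pi') eqxx in ii'.
have J0 : (0 < #|J|)%N by apply/card_gt0P; exists j.
by move=> /(leq_trans le); rewrite cardC1 leqNgt ltn_predL J0.
Qed.

Section SequencesOfType.
Variables (K : fieldType) (W : vectType K) (k : nat).
Variables (X : set W) (Xc : 'I_k -> set W) (alpha : 'I_k -> nat).

(* The type has as many entries as the sequence, so every point lies in a
   component. *)
Lemma sequences_of_type_index (x : {ffun 'I_(\sum_i alpha i) -> W}) :
  sequences_of_type Xc X x ->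
  exists2 c : 'I_(\sum_i alpha i) -> 'I_k,
    forall j i, Xc i (x j) <-> i = c j &
    forall i, #|[pred j | c j == i]| = alpha i.
Proof.
move=> [_ card_alpha uniq_comp].
have comp j : exists i, x j \in Xc i.
  apply: (exists_of_unique_count (P := fun j i => x j \in Xc i)) => [l i i'|].
    by move=> /set_mem xi /set_mem; apply: uniq_comp.
  by rewrite card_ord; apply: leq_sum => i _; rewrite -card_alpha.
have /choice[c cP] j : exists i, Xc i (x j) by have [i /set_mem] := comp j; exists i.
have cE j i : Xc i (x j) <-> i = c j.
  by split=> [xi|->//]; apply: uniq_comp xi (cP j).
exists c => // i; rewrite -card_alpha; apply: eq_card => j; rewrite !inE.
by apply/eqP/idP => [<-|/set_mem/cE ->//]; apply/mem_set/cE.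
Qed.

End SequencesOfType.

(** * From one spanning family to general sequences of type [alpha] *)

Theorem theorem3p5 (R : realType) (G : groupType) (W V : vectType R[i])
  (rhoW : gmodule G W) (rhoV : gmodule G V)
  (X : set W) (E : W -> {vspace V})
  (k : nat) (Xc : 'I_k.+1 -> set W) (N alpha : 'I_k.+1 -> nat)
  (V_irreducible : irreducible_gmodule rhoV)
  (X_cone : quasi_affine_cone X)
  (X_stable : stable_set rhoW X)
  (E_bundle : embedded_vector_bundle X E)
  (E_invariant : invariant_bundle rhoW rhoV X E)
  (X_components : set_bij setT (irreducible_component X) Xc)
  (E_rank : forall i x, Xc i x -> \dim (E x) = N i)
  (N_sorted : forall i j : 'I_k.+1, (i <= j)%N -> (N j <= N i)%N)
  (alpha_orbits : orbit_constant rhoW Xc alpha)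
  (alpha_ge : forall i, (N ord0 <= alpha i)%N)
  (alpha_sum : (\dim {:V})%:Z + ((N ord0)%:Z - 1) * (\sum_i (N i)%:Z)
                 < \sum_i (alpha i)%:Z * (N i)%:Z) :
  filling Xc alpha X E.
Proof.
have [Xc_fun Xc_inj Xc_surj] := X_components.
have Xc_comp i : irreducible_component X (Xc i) by apply: Xc_fun.
have XcX i : Xc i `<=` X by case: (Xc_comp i).
have irrXc i : irreducible_set (Xc i) by case: (Xc_comp i).
have injXc : injective Xc by move=> i i' /Xc_inj; apply; rewrite inE.
have gpoly g : polymap (rhoW g) by apply: polymap_linear => a u v; rewrite linearP.
have Xc_perm g i : exists i', rhoW g @` Xc i = Xc i'.
  have [i' _ <-] := Xc_surj _ (irreducible_component_image (gpoly g) (gpoly g^-1%g)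
    (gmoduleK rhoW g) (gmoduleVK rhoW g) (X_stable g) (X_stable g^-1%g) (Xc_comp i)).
  by exists i'.
have secE := embedded_vector_bundle_sections E_bundle.
have N_le i : (N i <= N ord0)%N by apply: N_sorted.
(* If [N ord0] were zero, all ranks would vanish and the numerical assumption would say that
   [\dim {:V}] is negative. *)
have [r Nr] : exists r, N ord0 = r.+1.
  case N0 : (N ord0) => [|r]; last by exists r.
  have N0i i : N i = 0%N by apply/eqP; rewrite -leqn0 -N0 N_le.
  move: alpha_sum; rewrite !big1 => [|i _|i _]; rewrite ?N0i ?mulr0 //.
have sum_lt : (\dim {:V} + r * \sum_i N i < \sum_i alpha i * N i)%N.
  rewrite -ltz_nat PoszD PoszM (big_morph Posz PoszD (erefl _)).
  rewrite (big_morph Posz PoszD (erefl _)); under [ltRHS]eq_bigr do rewrite PoszM.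
  by move: alpha_sum; rewrite Nr -addn1 PoszD addrK.
have alpha_le i : (alpha i <= \sum_i alpha i)%N by rewrite (bigD1 i) //= leq_addr.
have [|i|z Zz full_z] := full_block secE V_irreducible E_invariant XcX irrXc
  injXc Xc_perm alpha_orbits E_rank alpha_le _ _ sum_lt.
- by move=> i; rewrite -Nr.
- by rewrite -Nr.
set n := (\sum_i alpha i)%N in z Zz full_z alpha_le *.
pose XX : set {ffun 'I_n -> W} := [set x | forall j, X (x j)].
have [|O Oo OE] := @zariski_open_locally _ _ XX
    (fun x => (\sum_j E (x j))%VS = fullv).
  have sumT (x : {ffun 'I_n -> W}) :
      (\sum_(j in [set: 'I_n]%SET) E (x j) = \sum_j E (x j))%VS.
    by apply: eq_bigl => j; rewrite inE.
  move=> x Xx full_x.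
  have [|O [Oo Ox Ofull]] := poly_sections_full (C := 0%VS)
      (poly_sections_sum (A := [set: 'I_n]%SET) secE) Xx.
    by rewrite add0v sumT.
  by exists O; split=> // y Xy Oy; rewrite -(Ofull y Xy Oy) add0v sumT.
exists O; split=> // [O' O'o [y [Yy O'y]]|y Yy Oy]; last first.
  by apply/OE => //; case: Yy.
(* For density, a spanning sequence of type [alpha] is needed in the open set [O'] containing [y].
   It is sought in the irreducible product [Z] of the components through the points of [y]. *)
have [c cE c_card] := sequences_of_type_index Yy.
pose Z := prod_set (fun j => Xc (c j)).
have /irreducible_setP[_ irrZ] : irreducible_set Z by apply: irreducible_prod.
have /choice[F FP] i : exists F, zariski_closed F /\ Xc i = X `&` F.
  by have [F Fc ->] := irreducible_component_closed (Xc_comp i); exists F.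
(* The extra condition keeps each point off all other components, so that elements of [Z] in [O'']
   have type [alpha]. *)
pose O'' := O' `&` [set x : {ffun 'I_n -> W} | forall j i, i != c j -> ~ F i (x j)].
have O''o : zariski_open O''.
  apply: zariski_openI => //; apply: zariski_open_bigI_fin => j.
  apply: zariski_open_bigI_fin => i; case: (eqVneq i (c j)) => ic.
    by have := zariski_openT {ffun 'I_n -> W}; congr zariski_open; apply/seteqP.
  have pr_poly : polymap (fun x : {ffun 'I_n -> W} => x j).
    by apply: polymap_linear => a u v; rewrite !ffunE.
  have : zariski_open (~` F i) by rewrite /zariski_open setCK; case: (FP i).
  move=> /(zariski_open_preimage pr_poly); congr zariski_open.
  by apply/seteqP; split=> x /=; [move=> ? _ | apply].
have Yy' : XX y by case: Yy.
have [||x [Zx [Ox [O'x Fx]]]] := irrZ _ _ Oo O''o.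
(* [h] numbers the positions assigned to each component, so the fibers along [z] composed with [h]
   include all those of the spanning block; hence [Z] meets [O]. *)
- pose h j : 'I_k.+1 * 'I_(n + n).+1 :=
    (c j, inord (index j (enum [pred l | c l == c j]))).
  have Zh : Z [ffun j => z (h j)] by move=> j; rewrite ffunE; apply: Zz (h j).
  exists [ffun j => z (h j)]; split=> //; apply/OE.
    by move=> j; apply: XcX (Zh j).
  apply/eqP; rewrite eqEsubv subvf /= -full_z; apply/subv_sumP => -[i a].
  rewrite inE /= -c_card => lt.
  have [j0 _] : exists j, j \in [pred j | c j == i].
    by apply/card_gt0P; apply: leq_ltn_trans lt.
  rewrite cardE in lt; have := mem_nth j0 lt; set j := nth _ _ _.
  rewrite mem_enum inE => /eqP cj; apply: (sumv_sup j) => //.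
  by rewrite ffunE /h cj index_uniq ?enum_uniq // inord_val.
- exists y; split; first by move=> j; apply/cE.
  by split=> // j i /eqP ic Fi; apply: ic; apply/cE; case: (FP i) => _ ->.
have xE j i : Xc i (x j) <-> i = c j.
  split=> [xi|->]; last exact: Zx.
  apply: contrapT => /eqP ic; apply: (Fx j i ic).
  by move: xi; rewrite (FP i).2 => -[].
exists x; split=> //; split=> //; split.
- by move=> j; apply: XcX (Zx j).
- move=> i; rewrite -c_card; apply: eq_card => j; rewrite !inE.
  by apply/idP/eqP => [/set_mem/xE ->//|<-]; apply/mem_set/xE.
- by move=> j i i' /xE -> /xE ->.
Qed.
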